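(* Let $(A,\phi_{0})$ be a Jacobi algebroid over a manifold $M$, let $\omega\in\Gamma(\Lambda^2A^* )$ and let $N$ be a $(1,1)$-tensor field on $A$. Put $\tilde{\omega}=e^{t}\omega\in\Gamma(\Lambda^2\tilde A^* )$ and regard $N$ also as a $(1,1)$-tensor field on $\tilde{A}_{\bar{\phi}_{0}}$ independent of $t$. Then the pair $(\omega,N)$ is an $\Omega$N-structure (resp. a weak $\Omega$N-structure) on $(A,\phi_{0})$ if and only if the pair $(\tilde{\omega},N)$ is an $\Omega$N-structure (resp. a weak $\Omega$N-structure) on the Lie algebroid $\tilde{A}_{\bar{\phi}_{0}}$ over $M\times\mathbb{R}$.
   Context: Lie and Jacobi algebroids. A Lie algebroid over $M$ is a vector bundle $A\to M$ with a Lie bracket $[\cdot,\cdot]_A$ on $\Gamma(A)$ and a bundle map $\rho_A:A\to TM$ with $[X,fY]_A=f[X,Y]_A+(\rho_A(X)f)Y$. The differential $d_A$ on $\Gamma(\Lambda^*A^* )$ is the usual Lie algebroid differential: $(d_A\omega)(X_0,\dots,X_k)=\sum_i(-1)^i\rho_A(X_i)(\omega(X_0,\dots,\hat X_i,\dots,X_k))+\sum_{i<j}(-1)^{i+j}\omega([X_i,X_j]_A,X_0,\dots,\hat X_i,\dots,\hat X_j,\dots,X_k)$. A Jacobi algebroid $(A,\phi_0)$ is a Lie algebroid $A$ with $\phi_0\in\Gamma(A^* )$, $d_A\phi_0=0$; put $d_{A,\phi_0}\omega:=d_A\omega+\phi_0\wedge\omega$ on $\Gamma(\Lambda^*A^*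 )$. A $(1,1)$-tensor field on $A$ is a section of $A^*\otimes A$, i.e. a bundle map $N:A\to A$ over the identity, with dual $N^*:A^*\to A^*$. Its Nijenhuis torsion is $\mathcal{T}_N(X,Y):=[NX,NY]_A-N[NX,Y]_A-N[X,NY]_A+N^2[X,Y]_A$ for $X,Y\in\Gamma(A)$; $N$ is Nijenhuis if $\mathcal{T}_N=0$. For $\omega\in\Gamma(\Lambda^2A^* )$, $\langle\omega^\flat X,Y\rangle:=\omega(X,Y)$. $\Omega$N-structures. A pair $(\omega,N)$, $\omega\in\Gamma(\Lambda^2A^* )$ and $N$ a $(1,1)$-tensor field on $A$, is an $\Omega$N-structure on the Jacobi algebroid $(A,\phi_0)$ if $\omega^\flat\circ N=N^*\circ\omega^\flat$, $N$ is Nijenhuis, and both $\omega$ and $\omega_N$ are $d_{A,\phi_0}$-closed, where $\omega_N\in\Gamma(\Lambda^2A^* )$ is characterized by $\omega_N^\flat=\omega^\flat\circ N$. It is a weak $\Omega$N-structure if the same holds with the condition $\mathcal{T}_N=0$ replaced by $\omega^\flat(\mathcal{T}_N(X,Y))=0$ for all $X,Y\in\Gamma(A)$. A (weak) $\Omega$N-structure on a Lie algebroid $A$ is the same notion with $\phi_0=0$ (so closedness is with respect to $d_A$). The Lie algebroid $\tilde A_{\bar\phi_0}$. $\tilde A:=A\times\mathbb{R}$ is a vector bundle over $M\times\mathbb{R}$, with $t$ the standard coordinate on $\mathbb{R}$; its sections are identified with time-dependent sections of $A$, and operations of $A$ are applied pointwise in $t$. $\tilde A_{\bar\phi_0}$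 is $\tilde A$ with bracket $[\tilde X,\tilde Y\bar{]}_A^{\phi_0}:=[\tilde X,\tilde Y]_A+\langle\phi_0,\tilde X\rangle\frac{\partial\tilde Y}{\partial t}-\langle\phi_0,\tilde Y\rangle\frac{\partial\tilde X}{\partial t}$ and anchor $\bar\rho_A^{\phi_0}(\tilde X):=\rho_A(\tilde X)+\langle\phi_0,\tilde X\rangle\frac{\partial}{\partial t}$. *)

(* Defs.v *)
From HB Require Import structures.
From mathcomp Require Import all_boot all_order all_algebra.
From mathcomp Require Import all_classical all_reals all_analysis.

Set Implicit Arguments.
Unset Strict Implicit.
Unset Printing Implicit Defensive.

Import Order.TTheory GRing.Theory Num.Theory.
Import numFieldNormedType.Exports.

Local Open Scope classical_set_scope.
Local Open Scope ring_scope.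

(* [U] is meant to be open.  The partial derivatives are taken with the       *)
(* library's directional derivative along the canonical basis.                *)
Fixpoint Ck_on (R : realType) (n k : nat) (U : set 'rV[R]_n)
    (f : 'rV[R]_n -> R) : Prop :=
  (forall x, U x -> {for x, continuous f}) /\
  (if k is k'.+1 then
     forall i : 'I_n, (forall x, U x -> derivable f x (delta_mx 0 i)) /\
                      Ck_on k' U (fun x => 'D_(delta_mx 0 i) f x)
   else True).

Definition smooth_on (R : realType) (n : nat) (U : set 'rV[R]_n)
  (f : 'rV[R]_n -> R) : Prop := forall k, Ck_on k U f.

(* The chart [chart i] is a homeomorphism from the open set [chart_dom i] of  *)
(* the manifold onto an open set of R^n; [chart i] and [chart_inv i] have     *)
(* arbitrary values outside of these two open sets.                           *)
Record manifold (R : realType) (n : nat) := Manifold {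
  man_carrier :> topologicalType;
  man_hausdorff : hausdorff_space man_carrier;
  man_second_countable : @second_countable man_carrier;
  chart_index : Type;
  chart_dom : chart_index -> set man_carrier;
  chart : chart_index -> man_carrier -> 'rV[R]_n;
  chart_inv : chart_index -> 'rV[R]_n -> man_carrier;
  chart_dom_open : forall i, open (chart_dom i);
  chart_img_open : forall i, open (chart i @` chart_dom i);
  chart_cover : forall x, exists i, chart_dom i x;
  chartK : forall i x, chart_dom i x -> chart_inv i (chart i x) = x;
  chart_continuous : forall i x, chart_dom i x -> {for x, continuous (chart i)};
  chart_inv_continuous : forall i y, (chart i @` chart_dom i) y ->
    {for y, continuous (chart_inv i)};
  chart_smooth : forall i j l,
    smooth_on (chart i @` (chart_dom i `&` chart_dom j))
              (fun y => chart j (chart_inv i y) 0 l)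
}.
Arguments chart_index {R n} m.
Arguments chart_dom {R n m} i.
Arguments chart {R n m} i.
Arguments chart_inv {R n m} i.

Definition msmooth_on (R : realType) (n : nat) (M : manifold R n) (U : set M)
    (f : M -> R) : Prop :=
  forall i : chart_index M,
    smooth_on (chart i @` (chart_dom i `&` U)) (fun y => f (chart_inv i y)).

Definition msmooth (R : realType) (n : nat) (M : manifold R n) (f : M -> R) :=
  msmooth_on setT f.

(* A vector bundle of rank r, given by its fibres and local trivializations.  *)
Record vbundle (R : realType) (n : nat) (M : manifold R n) (r : nat) :=
  VBundle {
  fiber :> M -> vectType R;
  triv_index : Type;
  triv_dom : triv_index -> set M;
  triv : triv_index -> forall x : M, {linear fiber x -> 'rV[R]_r};
  triv_inv : triv_index -> forall x : M, 'rV[R]_r -> fiber x;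
  triv_dom_open : forall a, open (triv_dom a);
  triv_cover : forall x, exists a, triv_dom a x;
  trivK : forall a x, triv_dom a x -> cancel (triv a x) (triv_inv a x);
  triv_invK : forall a x, triv_dom a x -> cancel (triv_inv a x) (triv a x);
  triv_smooth : forall a b (i j : 'I_r),
    msmooth_on (triv_dom a `&` triv_dom b)
               (fun x => triv b x (triv_inv a x (delta_mx 0 i)) 0 j)
}.
Arguments fiber {R n M r} v x.
Arguments triv_index {R n M r} v.
Arguments triv_dom {R n M r v} a.
Arguments triv {R n M r v} a x.
Arguments triv_inv {R n M r v} a x.

Section Bundles.
Context {R : realType} {n : nat} {M : manifold R n} {r : nat}.
Implicit Type E : vbundle M r.

(* Not necessarily smooth sections; see [smooth_section].                     *)
Definition section E := forall x : M, E x.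

Definition frame E (a : triv_index E) (i : 'I_r) : section E :=
  fun x => triv_inv a x (delta_mx 0 i).

Definition smooth_section E (X : section E) : Prop :=
  forall (a : triv_index E) (i : 'I_r),
    msmooth_on (triv_dom a) (fun x => triv a x (X x) 0 i).

Definition kform E (k : nat) := forall x : M, ('I_k -> E x) -> R.

(* [is_form w] : w is a (smooth) section of the k-th exterior power of E^*.   *)
Record is_form E (k : nat) (w : kform E k) : Prop := IsForm {
  form_linear : forall x (v : 'I_k -> E x) (i : 'I_k) (a : R) (u1 u2 : E x),
    w x [eta v with i |-> a *: u1 + u2] =
    a * w x [eta v with i |-> u1] + w x [eta v with i |-> u2];
  form_alternating : forall x (v : 'I_k -> E x) (i j : 'I_k),
    i != j -> v i = v j -> w x v = 0;
  form_smooth : forall (a : triv_index E) (I : 'I_k -> 'I_r),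
    msmooth_on (triv_dom a) (fun x => w x (fun l => frame a (I l) x))
}.

Definition zero_form E (k : nat) : kform E k := fun _ _ => 0.

(* The pairing of a 1-form with a vector.                                     *)
Definition pairing E (phi : kform E 1) (x : M) (u : E x) : R :=
  phi x (fun _ => u).

Definition wedge1 E (k : nat) (phi : kform E 1) (w : kform E k) : kform E k.+1 :=
  fun x v => \sum_(i < k.+1) (-1) ^+ i * pairing phi (v i) *
                             w x (fun l => v (lift i l)).

Definition tensor11 E := forall x : M, {linear E x -> E x}.

Definition smooth_tensor11 E (N : tensor11 E) : Prop :=
  forall (a : triv_index E) (i j : 'I_r),
    msmooth_on (triv_dom a) (fun x => triv a x (N x (frame a i x)) 0 j).

Definition tensor_app E (N : tensor11 E) (X : section E) : section E :=
  fun x => N x (X x).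

Definition tensor_dual E (N : tensor11 E) (x : M) (al : E x -> R) : E x -> R :=
  al \o N x.

Definition pair2 (T : Type) (u v : T) : 'I_2 -> T :=
  fun i => if i == ord0 then u else v.

Definition flat E (w : kform E 2) (x : M) (u : E x) : E x -> R :=
  fun v => w x (pair2 u v).

(* The form w_N; [flat (form_tensor w N) x] is [flat w x \o N x].             *)
Definition form_tensor E (w : kform E 2) (N : tensor11 E) : kform E 2 :=
  fun x v => w x (pair2 (N x (v ord0)) (v ord_max)).

End Bundles.
Arguments zero_form {R n M r} E k.

(* Elements of T_x M, as derivations at x of the algebra of smooth functions. *)
Record tangent_vector (R : realType) (n : nat) (M : manifold R n) (x : M)
    (D : (M -> R) -> R) : Prop := TangentVector {
  tangent_linear : forall (a : R) (f g : M -> R), msmooth f -> msmooth g ->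
    D (fun y => a * f y + g y) = a * D f + D g;
  tangent_leibniz : forall f g : M -> R, msmooth f -> msmooth g ->
    D (fun y => f y * g y) = f x * D g + g x * D f
}.

(* The operations of a Lie algebroid; the axioms are in [lie_algebroid].  The *)
(* value of the bracket on non-smooth sections is irrelevant, and so is that  *)
(* of [anchor u f] for f not smooth.                                          *)
Record algebroid (R : realType) (n : nat) (M : manifold R n) (r : nat) :=
  Algebroid {
  alg_bundle :> vbundle M r;
  bracket : section alg_bundle -> section alg_bundle -> section alg_bundle;
  anchor : forall x : M, alg_bundle x -> (M -> R) -> R
}.
Arguments bracket {R n M r A} X Y : rename.
Arguments anchor {R n M r} A {x} u f : rename.

Record lie_algebroid (R : realType) (n : nat) (M : manifold R n) (r : nat)
    (A : algebroid M r) : Prop := LieAlgebroid {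
  bracket_smooth : forall X Y : section A,
    smooth_section X -> smooth_section Y -> smooth_section (bracket X Y);
  bracket_linear : forall (a : R) (X Y Z : section A),
    smooth_section X -> smooth_section Y -> smooth_section Z ->
    forall x, bracket (fun y => a *: X y + Y y) Z x =
              a *: bracket X Z x + bracket Y Z x;
  bracket_antisym : forall X Y : section A,
    smooth_section X -> smooth_section Y ->
    forall x, bracket X Y x = - bracket Y X x;
  bracket_jacobi : forall X Y Z : section A,
    smooth_section X -> smooth_section Y -> smooth_section Z ->
    forall x, bracket X (bracket Y Z) x + bracket Y (bracket Z X) x
              + bracket Z (bracket X Y) x = 0;
  anchor_tangent : forall (x : M) (u : A x), tangent_vector x (anchor A u);
  anchor_linear : forall (x : M) (a : R) (u v : A x) (f : M -> R),
    msmooth f -> anchor A (a *: u + v) f = a * anchor A u f + anchor A v f;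
  anchor_smooth : forall (a : triv_index A) (i : 'I_r) (f : M -> R),
    msmooth f ->
    msmooth_on (triv_dom a) (fun x => anchor A (frame a i x) f);
  bracket_leibniz : forall (f : M -> R) (X Y : section A),
    msmooth f -> smooth_section X -> smooth_section Y ->
    forall x, bracket X (fun y => f y *: Y y) x =
              f x *: bracket X Y x + anchor A (X x) f *: Y x
}.

Section Structures.
Context {R : realType} {n : nat} {M : manifold R n} {r : nat}.
Implicit Type A : algebroid M r.

(* The sections fed to w in the second sum are [X_i, X_j] followed by the     *)
(* X_m with m different from i and j, in increasing order: for i < j and      *)
(* 0 < l, the index bump i (bump j.-1 l.-1) is the (l-1)-th such m.           *)
Definition dA A (k : nat) (w : kform A k) (X : 'I_k.+1 -> section A) (x : M)
    : R :=
  \sum_(i < k.+1) (-1) ^+ i *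
      anchor A (X i x) (fun y => w y (fun l => X (lift i l) y))
  + \sum_(i < k.+1) \sum_(j < k.+1 | (i < j)%N) (-1) ^+ (i + j) *
      w x (fun l : 'I_k => if l == 0 :> nat then bracket (X i) (X j) x
                           else X (inord (bump i (bump j.-1 l.-1))) x).

Definition dA_phi A (phi : kform A 1) (k : nat) (w : kform A k)
    (X : 'I_k.+1 -> section A) (x : M) : R :=
  dA w X x + wedge1 phi w (fun i => X i x).

Definition closed_form A (k : nat) (w : kform A k) : Prop :=
  forall X : 'I_k.+1 -> section A, (forall i, smooth_section (X i)) ->
    forall x, dA w X x = 0.

Definition phi_closed A (phi : kform A 1) (k : nat) (w : kform A k) : Prop :=
  forall X : 'I_k.+1 -> section A, (forall i, smooth_section (X i)) ->
    forall x, dA_phi phi w X x = 0.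

Record jacobi_algebroid A (phi0 : kform A 1) : Prop := JacobiAlgebroid {
  jacobi_lie : lie_algebroid A;
  jacobi_form : is_form phi0;
  jacobi_closed : closed_form phi0
}.

Definition torsion A (N : tensor11 A) (X Y : section A) : section A :=
  fun x => bracket (tensor_app N X) (tensor_app N Y) x
           - N x (bracket (tensor_app N X) Y x)
           - N x (bracket X (tensor_app N Y) x)
           + N x (N x (bracket X Y x)).

Definition nijenhuis A (N : tensor11 A) : Prop :=
  forall X Y : section A, smooth_section X -> smooth_section Y ->
    forall x, torsion N X Y x = 0.

Record OmegaN_structure A (phi0 : kform A 1) (w : kform A 2) (N : tensor11 A)
    : Prop := OmegaNStructure {
  OmegaN_compatible : forall x, flat w (x := x) \o N x =
                                tensor_dual N (x := x) \o flat w (x := x);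
  OmegaN_nijenhuis : nijenhuis N;
  OmegaN_closed : phi_closed phi0 w;
  OmegaN_closedN : phi_closed phi0 (form_tensor w N)
}.

Record weak_OmegaN_structure A (phi0 : kform A 1) (w : kform A 2)
    (N : tensor11 A) : Prop := WeakOmegaNStructure {
  wOmegaN_compatible : forall x, flat w (x := x) \o N x =
                                 tensor_dual N (x := x) \o flat w (x := x);
  wOmegaN_torsion : forall X Y : section A,
    smooth_section X -> smooth_section Y ->
    forall x, flat w (torsion N X Y x) = (fun _ => 0);
  wOmegaN_closed : phi_closed phi0 w;
  wOmegaN_closedN : phi_closed phi0 (form_tensor w N)
}.

End Structures.

Section SmoothLemmas.
Context {R : realType}.

Lemma Ck_on_cst n k (U : set 'rV[R]_n) (c : R) : Ck_on k U (fun=> c).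
Proof.
elim: k c => [|k IH] c /=; split => //; try by move=> x _; exact: cst_continuous.
move=> i; split=> [x _|]; first exact: derivable_cst.
have -> : (fun x : 'rV[R]_n => 'D_(delta_mx 0 i) (fun=> c) x) = (fun=> 0 : R).
  by apply/funext => x; rewrite derive_cst.
exact: IH.
Qed.

Lemma delta_lsubmx n (i : 'I_(n + 1)) :
  (exists j, lsubmx (delta_mx 0 i : 'rV[R]_(n + 1)) = delta_mx 0 j) \/
  lsubmx (delta_mx 0 i : 'rV[R]_(n + 1)) = 0.
Proof.
case: (split_ordP i) => j ->; [left; exists j|right];
  apply/rowP => l; rewrite !mxE /=.
- by rewrite (inj_eq (@lshift_inj _ _)).
- by rewrite eq_lrshift.
Qed.

Lemma quotient_lsubmx n (f : 'rV[R]_n -> R) (x v : 'rV[R]_(n + 1)) :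
  (fun h : R => h^-1 *: (((fun y => f (lsubmx y)) \o shift x) (h *: v)
                         - f (lsubmx x))) =
  (fun h : R => h^-1 *: ((f \o shift (lsubmx x)) (h *: lsubmx v)
                         - f (lsubmx x))).
Proof.
apply/funext => h /=; congr (_ *: (f _ - _)).
by apply/rowP => l; rewrite !mxE.
Qed.

Lemma derive_dir0 n (f : 'rV[R]_n -> R) x : derivable f x 0 /\ 'D_0 f x = 0.
Proof.
have E : (fun h : R => h^-1 *: ((f \o shift x) (h *: 0) - f x)) = fun=> 0.
  by apply/funext => h /=; rewrite scaler0 add0r subrr scaler0.
rewrite /derivable /derive E; split; first exact: is_cvg_cst.
by rewrite lim_cst.
Qed.

Lemma Ck_on_lsubmx n k (V : set 'rV[R]_n) (f : 'rV[R]_n -> R) :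
  Ck_on k V f -> Ck_on k [set y : 'rV[R]_(n + 1) | V (lsubmx y)]
                       (fun y => f (lsubmx y)).
Proof.
elim: k f => [|k IH] f /= [cf df]; (split; [move=> x Vx|]) => //.
- by apply: continuous_comp; [exact: continuous_lsubmx|exact: cf].
- by apply: continuous_comp; [exact: continuous_lsubmx|exact: cf].
move=> i; have dE x : 'D_(delta_mx 0 i) (fun y => f (lsubmx y)) x =
    'D_(lsubmx (delta_mx 0 i : 'rV[R]_(n + 1))) f (lsubmx x).
  by rewrite /derive quotient_lsubmx.
split=> [x Vx|].
  rewrite /derivable quotient_lsubmx.
  case: (delta_lsubmx i) => [[j ->]|->]; first exact: (df j).1.
  exact: (derive_dir0 f (lsubmx x)).1.
rewrite (funext dE).
case: (delta_lsubmx i) => [[j ->]|->]; first exact: (IH _ (df j).2).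
rewrite (funext (fun x : 'rV[R]_(n + 1) => (derive_dir0 f (lsubmx x)).2)).
exact: Ck_on_cst.
Qed.

Lemma smooth_on_lsubmx n (V : set 'rV[R]_n) (f : 'rV[R]_n -> R) :
  smooth_on V f -> smooth_on [set y : 'rV[R]_(n + 1) | V (lsubmx y)]
                             (fun y => f (lsubmx y)).
Proof. by move=> sf k; exact: Ck_on_lsubmx. Qed.

Lemma smooth_on_coord n (U : set 'rV[R]_n) (l : 'I_n) :
  smooth_on U (fun y => y 0 l).
Proof.
case=> [|k] /=; split => //; try by move=> x _; exact: coord_continuous.
move=> i; have dE (x : 'rV[R]_n) :
    (h^-1 *: (((fun y : 'rV[R]_n => y 0 l) \o shift x) (h *: delta_mx 0 i)
              - x 0 l)) @[h --> 0^'] --> (delta_mx 0 i : 'rV[R]_n) 0 l.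
  apply: (@cvg_trans _ ((fun=> (delta_mx 0 i : 'rV[R]_n) 0 l) @ (0 : R)^')).
    apply: near_eq_cvg; near=> h.
    rewrite /= [in RHS]mxE addrK [in RHS]mxE /GRing.scale /= mulKf //.
    by near: h; exact: nbhs_dnbhs_neq.
  exact: cvg_cst.
split=> [x _|]; first by apply/cvg_ex; eexists; exact: dE.
rewrite (_ : (fun x => 'D__ _ x) = fun=> (delta_mx 0 i : 'rV[R]_n) 0 l).
  exact: Ck_on_cst.
by apply/funext => x; apply/cvg_lim; [exact: norm_hausdorff|exact: dE].
Unshelve. all: by end_near. Qed.

Lemma smooth_on_subset n (U V : set 'rV[R]_n) (f : 'rV[R]_n -> R) :
  U `<=` V -> smooth_on V f -> smooth_on U f.
Proof.
move=> UV sf k; have {sf} := sf k.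
elim: k f => [|k IH] f /= [cf df]; split => //; try by move=> x /UV /cf.
by move=> i; split=> [x /UV|]; [exact: (df i).1|exact: IH (df i).2].
Qed.

End SmoothLemmas.

Section Topology.

Lemma prod_hausdorff (T U : topologicalType) :
  hausdorff_space T -> hausdorff_space U -> hausdorff_space (T * U)%type.
Proof.
move=> hT hU [x1 x2] [y1 y2] cl; congr pair.
- apply: hT => A B nA nB.
  have [||[z1 z2] [/= ? ?]] := cl (A `*` setT) (B `*` setT).
  + by exists (A, setT) => //; split => //; exact: filterT.
  + by exists (B, setT) => //; split => //; exact: filterT.
  + by exists z1; split; tauto.
- apply: hU => A B nA nB.
  have [||[z1 z2] [/= ? ?]] := cl (setT `*` A) (setT `*` B).
  + by exists (setT, A) => //; split => //; exact: filterT.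
  + by exists (setT, B) => //; split => //; exact: filterT.
  + by exists z2; split; tauto.
Qed.

Lemma open_setX (T U : topologicalType) (A : set T) (B : set U) :
  open A -> open B -> open (A `*` B).
Proof.
rewrite !openE => oA oB [x y] [/= Ax By].
by exists (A, B) => //; split; [exact: oA|exact: oB].
Qed.

Lemma prod_second_countable (T U : topologicalType) :
  @second_countable T -> @second_countable U -> @second_countable (T * U)%type.
Proof.
move=> [BT cT [oT bT]] [BU cU [oU bU]].
exists ((fun p : set T * set U => p.1 `*` p.2) @` (BT `*` BU)).
  exact/(sub_countable (card_image_le _ _))/countableX.
split=> [_ [[A B] [/= /oT oA /oU oB] <-]|[x y] W [[P Q] [/= nP nQ] PQW]].
  exact: open_setX.
have [A [BA Ax] AP] := bT x P nP; have [B [BB By] BQ] := bU y Q nQ.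
exists (A `*` B); first by split => //; exists (A, B).
by move=> [a b] [/= Aa Bb]; apply: PQW; split; [exact: AP|exact: BQ].
Qed.

Lemma R_second_countable (R : realType) : @second_countable R.
Proof.
pose I (p : rat * rat) : set R := `]ratr p.1, ratr p.2[%classic.
exists (I @` setT).
  exact/(sub_countable (card_image_le _ _))/countableP.
split=> [_ [p _ <-]|x W /nbhs_ballP[e /= e0 eW]]; first exact: interval_open.
have [p] : exists p, ratr p \in `]x - e, x[.
  by have /rat_in_itvoo[p ?] : x - e < x; [rewrite ltrBlDr ltrDl|exists p].
have [q] : exists q, ratr q \in `]x, x + e[.
  by have /rat_in_itvoo[q ?] : x < x + e; [rewrite ltrDl|exists q].
rewrite !in_itv /= => /andP[xq qe] /andP[ep px].
exists (I (p, q)); first by split; [exists (p, q)|rewrite /I /= in_itv /= px xq].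
move=> y; rewrite /I /= in_itv /= => /andP[py yq]; apply: eW.
rewrite /ball /= ltr_distlC (lt_trans ep py) /=.
by rewrite (lt_trans yq qe).
Qed.

End Topology.

Section ProductWithLine.
Context {R : realType} {n : nat} (M : manifold R n).

Let dom (i : chart_index M) : set (M * R)%type := chart_dom i `*` setT.
Let ch (i : chart_index M) (p : M * R) : 'rV[R]_(n + 1) :=
  row_mx (chart i p.1) (p.2)%:M.
Let chV (i : chart_index M) (y : 'rV[R]_(n + 1)) : M * R :=
  (chart_inv i (lsubmx y), rsubmx y 0 0).

Lemma prodR_img i (U : set M) :
  ch i @` (dom i `&` (U `*` setT)) =
  [set y | (chart i @` (chart_dom i `&` U)) (lsubmx y)].
Proof.
apply/seteqP; split=> [_ [[x t] [[/= Dx _] [Ux _]] <-]|y /= [x [Dx Ux] xy]].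
  by rewrite /= row_mxKl; exists x.
exists (x, rsubmx y 0 0) => //.
by rewrite /ch /= xy -mx11_scalar hsubmxK.
Qed.

Lemma prodR_img_dom i :
  ch i @` dom i = [set y | (chart i @` chart_dom i) (lsubmx y)].
Proof. by have := prodR_img i setT; rewrite setXTT !setIT. Qed.

Lemma prodR_continuous i p : dom i p -> {for p, continuous (ch i)}.
Proof.
case: p => x t [/= Dx _] W.
move=> /nbhs_ballP[e /= e0 eW].
have /= := chart_continuous Dx => /(_ (ball (chart i x) e)).
move=> /(_ (nbhsx_ballx _ _ e0)) nP.
exists (chart i @^-1` ball (chart i x) e, ball t e) => /=.
  by split => //; exact: nbhsx_ballx.
move=> [x' t'] [/= [_ bx] bt]; apply: eW; split => // a b.
rewrite /ch /= !mxE; case: split_ordP => c _; first exact: bx.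
by rewrite !mxE !ord1 !eqxx !mulr1n.
Qed.

Lemma prodR_inv_continuous i y :
  (ch i @` dom i) y -> {for y, continuous (chV i)}.
Proof.
rewrite prodR_img_dom => /= Dy.
have c1 : {for y, continuous (fun y => chart_inv i (lsubmx y))}.
  apply: continuous_comp; first exact: continuous_lsubmx.
  exact: chart_inv_continuous.
have c2 : {for y, continuous (fun y : 'rV[R]_(n + 1) => rsubmx y 0 0)}.
  apply: (@continuous_comp _ _ _ rsubmx (fun z : 'rV[R]_1 => z 0 0)).
    exact: continuous_rsubmx.
  exact: coord_continuous.
exact: cvg_pair c1 c2.
Qed.

Lemma prodR_smooth i j l :
  smooth_on (ch i @` (dom i `&` dom j)) (fun y => ch j (chV i y) 0 l).
Proof.
rewrite prodR_img; case: (split_ordP l) => l' ->.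
  rewrite (_ : (fun y => _) =
    (fun y => chart j (chart_inv i (lsubmx y)) 0 l')).
    exact: (smooth_on_lsubmx (chart_smooth (m := M) i j l')).
  by apply/funext => y; rewrite /ch row_mxEl.
rewrite (_ : (fun y => _) = (fun y : 'rV[R]_(n + 1) => y 0 (rshift n l'))).
  exact: smooth_on_coord.
by apply/funext => y; rewrite /ch row_mxEr !mxE !ord1 eqxx mulr1n /= !mxE.
Qed.

(* The manifold M x R, with charts (x, t) |-> (chart i x, t).                 *)
Program Definition prodR : manifold R (n + 1) := {|
  man_carrier := (M * R)%type;
  chart_index := chart_index M;
  chart_dom := dom;
  chart := ch;
  chart_inv := chV;
  chart_continuous := prodR_continuous;
  chart_inv_continuous := prodR_inv_continuous;
  chart_smooth := prodR_smooth
|}.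
Next Obligation.
by apply: prod_hausdorff; [exact: man_hausdorff|exact: norm_hausdorff].
Qed.
Next Obligation.
apply: prod_second_countable; first exact: man_second_countable.
exact: R_second_countable.
Qed.
Next Obligation.
by move=> i; apply: open_setX; [exact: chart_dom_open|exact: openT].
Qed.
Next Obligation.
move=> i; rewrite prodR_img_dom.
apply: (@open_comp _ _ lsubmx); last exact: chart_img_open.
by move=> y _; exact: continuous_lsubmx.
Qed.
Next Obligation.
by move=> [x t]; have [i Dx] := chart_cover x; exists i.
Qed.
Next Obligation.
move=> i [x t] [/= Dx _].
by rewrite /chV /ch /= row_mxKl row_mxKr chartK // mxE eqxx mulr1n.
Qed.

Lemma msmooth_on_fst (U : set M) (f : M -> R) : msmooth_on U f ->
  @msmooth_on R (n + 1) prodR (U `*` setT) (fun p => f p.1).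
Proof.
by move=> sf i; rewrite /= prodR_img; exact: smooth_on_lsubmx (sf i).
Qed.

End ProductWithLine.

(* The vector bundle A x R over M x R: the pull-back of A along the first     *)
(* projection, whose fibre at (x, t) is A x.                                  *)
Program Definition tilde_bundle (R : realType) (n : nat) (M : manifold R n)
    (r : nat) (E : vbundle M r) : vbundle (prodR M) r := {|
  fiber := fun p : prodR M => E p.1;
  triv_index := triv_index E;
  triv_dom := fun a => triv_dom a `*` setT;
  triv := fun a p => triv a p.1;
  triv_inv := fun a p => triv_inv a p.1
|}.
Next Obligation.
by move=> *; apply: open_setX; [exact: triv_dom_open|exact: openT].
Qed.
Next Obligation.
by move=> R n M r E [x t]; have [a Dx] := triv_cover E x; exists a.
Qed.
Next Obligation. by move=> R n M r E a [x t] [/= Dx _]; exact: trivK. Qed.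
Next Obligation. by move=> R n M r E a [x t] [/= Dx _]; exact: triv_invK. Qed.
Next Obligation.
move=> R n M r E a b i j /=.
have := msmooth_on_fst (triv_smooth a b i j).
by rewrite -[X in _ `*` X]setIT -setXI.
Qed.

(* The derivative of a curve in a finite-dimensional vector space, computed   *)
(* in coordinates.                                                            *)
Definition curve_derive (R : realType) (V : vectType R) (c : R -> V) (t : R)
    : V :=
  \sum_(i < \dim {:V})
    derive1 (fun s => coord (vbasis {:V}) i (c s)) t *: (vbasis {:V})`_i.

Section Tilde.
Context {R : realType} {n : nat} {M : manifold R n} {r : nat}.

Definition slice (E : vbundle M r) (X : section (tilde_bundle E)) (t : R)
  : section E := fun x => X (x, t).

Definition time_derive (E : vbundle M r) (X : section (tilde_bundle E))
    : section (tilde_bundle E) :=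
  fun p => curve_derive (fun s => slice X s p.1) p.2.

(* The Lie algebroid written A~ with a bar over phi0.                         *)
Definition tilde_algebroid (A : algebroid M r) (phi0 : kform A 1)
    : algebroid (prodR M) r := {|
  alg_bundle := tilde_bundle A;
  bracket := fun X Y p =>
    bracket (slice X p.2) (slice Y p.2) p.1
    + pairing phi0 (slice X p.2 p.1) *: time_derive Y p
    - pairing phi0 (slice Y p.2 p.1) *: time_derive X p;
  anchor := fun (p : prodR M) (u : A p.1) f =>
    anchor A u (fun y => f (y, p.2))
    + pairing phi0 u * derive1 (fun s => f (p.1, s)) p.2
|}.

Definition exp_form (E : vbundle M r) (k : nat) (w : kform E k)
  : kform (tilde_bundle E) k := fun p v => expR p.2 * w p.1 v.

Definition tilde_tensor (E : vbundle M r) (N : tensor11 E)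
  : tensor11 (tilde_bundle E) := fun p => N p.1.

End Tilde.

(* Main.v *)
Require Import Defs.
From mathcomp Require Import all_boot all_order all_algebra.
From mathcomp Require Import all_classical all_reals all_analysis.
From mathcomp Require Import ring lra.

Set Implicit Arguments.
Unset Strict Implicit.
Unset Printing Implicit Defensive.

Import Order.TTheory GRing.Theory Num.Theory.
Import numFieldNormedType.Exports.

Local Open Scope classical_set_scope.
Local Open Scope ring_scope.

(** Every condition on the pair over M x R can be read on the time slices of
    the sections involved, where it becomes the corresponding condition over
    M.

    Compatibility of the form with [N] is fibrewise, and the factor exp(t) does
    not vanish.

    The bracket over M x R differs from the bracket of the slices only by
    multiples of time derivatives of the sections.  As [N] is linear on fibres
    and independent of t, it commutes with the time derivative, and all these
    extra terms cancel in the torsion: the torsion of [N] over M x R at (x, t)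
    is the torsion of [N] over M on the slices at time t ([tilde_torsion]).

    In the differential of exp(t) w, the anchor differentiates exp(t) w(Y, Z)
    along M and along time.  By the product rule the time derivative has three
    terms.  The one where exp(t) is differentiated adds up to exp(t) times the
    wedge product of phi0 with w; those where a section is differentiated
    cancel, by antisymmetry of w, against the time derivatives in the brackets.
    So the differential of exp(t) w at (x, t) is exp(t) times the twisted
    differential of w on the slices ([tilde_dA_exp]).  The same applies to the
    form w_N, which is a 2-form as soon as w and N are compatible
    ([is_form_tensor]).

    Slices of smooth sections are smooth, and a smooth section over M is the
    slice of a smooth section that does not depend on time; hence the
    quantifiers over sections also correspond.

    The analytic content is the closure of smooth functions under sums,
    products and slicing, which makes w(Y, Z) smooth for smooth Y and Z, and
    the product rule for a bilinear form along two curves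
    ([is_derive_bilinear]). *)

(** * Smooth functions on open subsets of R^n *)

Section EuclideanSmoothness.
Context {R : realType}.

Lemma Ck_on_pred n k (U : set 'rV[R]_n) f : Ck_on k.+1 U f -> Ck_on k U f.
Proof.
elim: k f => [|k IH] f [cf df]; first by split.
by split => // i; split; [exact: (df i).1|exact: IH (df i).2].
Qed.

(** The sets need not be open, because [Ck_on] is a condition at each point of
    the set. *)
Lemma Ck_on_bigcup n k (I : Type) (U : I -> set 'rV[R]_n) f :
  (forall i, Ck_on k (U i) f) -> Ck_on k (\bigcup_i U i) f.
Proof.
elim: k f => [|k IH] f sf; split => //;
  try by move=> x [i _ Ux]; exact: (sf i).1.
move=> j; split=> [x [i _ Ux]|]; first exact: ((sf i).2 j).1.
by apply: IH => i; exact: ((sf i).2 j).2.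
Qed.

Lemma continuous_at_ext (T S : topologicalType) (U : set T) (f g : T -> S) x :
  open U -> (forall x, U x -> f x = g x) -> U x ->
  {for x, continuous f} -> {for x, continuous g}.
Proof.
move=> oU fg Ux cf; suff: g @ x --> g x by [].
rewrite -(fg _ Ux); apply: cvg_trans cf; apply: near_eq_cvg.
near=> y; apply: fg; near: y; exact: open_nbhs_nbhs.
Unshelve. all: by end_near. Qed.

Lemma Ck_on_ext n k (U : set 'rV[R]_n) (f g : 'rV[R]_n -> R) :
  open U -> (forall x, U x -> f x = g x) -> Ck_on k U f -> Ck_on k U g.
Proof.
move=> oU; elim: k f g => [|k IH] f g fg [cf df]; split=> //;
  try by move=> x Ux; exact: (continuous_at_ext oU fg Ux (cf x Ux)).
have nfg x (Ux : U x) : \near x, f x = g x.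
  by near=> y; apply: fg; near: y; exact: open_nbhs_nbhs.
move=> i; split=> [x Ux|].
  exact: near_eq_derivable (nfg x Ux) ((df i).1 x Ux).
by apply: IH (df i).2 => x Ux; apply: near_eq_derive; exact: nfg.
Unshelve. all: by end_near. Qed.

Lemma Ck_onD n k (U : set 'rV[R]_n) (f g : 'rV[R]_n -> R) :
  open U -> Ck_on k U f -> Ck_on k U g -> Ck_on k U (fun x => f x + g x).
Proof.
move=> oU; elim: k f g => [|k IH] f g [cf df] [cg dg];
  (split; [by move=> x Ux; apply: continuousD; [exact: cf|exact: cg]|]) => //.
move=> i; split=> [x Ux|].
  by apply: derivableD; [exact: (df i).1|exact: (dg i).1].
apply: Ck_on_ext oU _ (IH _ _ (df i).2 (dg i).2) => x Ux.
by rewrite -deriveD //; [exact: (df i).1|exact: (dg i).1].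
Qed.

Lemma Ck_onM n k (U : set 'rV[R]_n) (f g : 'rV[R]_n -> R) :
  open U -> Ck_on k U f -> Ck_on k U g -> Ck_on k U (fun x => f x * g x).
Proof.
move=> oU; elim: k f g => [|k IH] f g sf sg;
  (split; [move=> x Ux|]) => //;
  try by apply: continuousM; [exact: sf.1|exact: sg.1].
have [df dg] := (sf.2, sg.2).
move=> i; split=> [x Ux|].
  by apply: derivableM; [exact: (df i).1|exact: (dg i).1].
apply: (Ck_on_ext oU _ (Ck_onD oU (IH _ _ (Ck_on_pred sf) (dg i).2)
                                  (IH _ _ (Ck_on_pred sg) (df i).2))) => x Ux.
by rewrite -deriveM //; [exact: (df i).1|exact: (dg i).1].
Qed.

Lemma continuous_row_mxl m n (c : 'rV[R]_n) :
  continuous (fun y : 'rV[R]_m => row_mx y c).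
Proof.
move=> y W /nbhs_ballP[e /= e0 eW].
apply/nbhs_ballP; exists e => //= z [_ yz]; apply: eW; split => // a b.
rewrite !mxE; case: split_ordP => d _; first exact: yz.
exact: ballxx.
Qed.

(** The difference quotient of [f (row_mx y c)] in the direction [v] is that of
    [f] in the direction [row_mx v 0]. *)
Lemma quotient_row_mxl m n (c : 'rV[R]_n) (f : 'rV[R]_(m + n) -> R) y v :
  (fun h : R => h^-1 *: (((fun y => f (row_mx y c)) \o shift y) (h *: v)
                         - f (row_mx y c))) =
  (fun h : R => h^-1 *: ((f \o shift (row_mx y c)) (h *: row_mx v 0)
                         - f (row_mx y c))).
Proof.
by apply/funext => h /=; rewrite scale_row_mx scaler0 add_row_mx add0r.
Qed.

Lemma delta_mx_lshift m n (i : 'I_m) :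
  row_mx (delta_mx 0 i) 0 = delta_mx 0 (lshift n i) :> 'rV[R]_(m + n).
Proof.
apply/rowP => l; rewrite !mxE; case: split_ordP => j ->; rewrite !mxE /=.
  by rewrite (inj_eq (@lshift_inj _ _)).
by rewrite eq_rlshift.
Qed.

Lemma Ck_on_row_mxl m n k (c : 'rV[R]_n) (V : set 'rV[R]_(m + n)) f :
  Ck_on k V f ->
  Ck_on k [set y : 'rV[R]_m | V (row_mx y c)] (fun y => f (row_mx y c)).
Proof.
elim: k f => [|k IH] f [cf df]; (split; [move=> x Vx|]) => //.
- by apply: continuous_comp; [exact: continuous_row_mxl|exact: cf].
- by apply: continuous_comp; [exact: continuous_row_mxl|exact: cf].
move=> i; split=> [y Vy|].
  rewrite /derivable quotient_row_mxl delta_mx_lshift; exact: (df _).1.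
rewrite (_ : (fun y => _) =
             fun y => 'D_(delta_mx 0 (lshift n i)) f (row_mx y c)).
  exact: IH (df _).2.
by apply/funext => y; rewrite /derive quotient_row_mxl delta_mx_lshift.
Qed.

Lemma smooth_on_row_mxl m n (c : 'rV[R]_n) (V : set 'rV[R]_(m + n)) f :
  smooth_on V f ->
  smooth_on [set y : 'rV[R]_m | V (row_mx y c)] (fun y => f (row_mx y c)).
Proof. by move=> sf k; exact: Ck_on_row_mxl. Qed.

End EuclideanSmoothness.

(** * Smooth functions on manifolds *)

Section ManifoldSmoothness.
Context {R : realType} {n : nat} {M : manifold R n}.
Implicit Types (U : set M) (f g : M -> R).

Lemma chart_open_img (i : chart_index M) U :
  open U -> open (chart i @` (chart_dom i `&` U)).
Proof.
move=> oU.
have -> : chart i @` (chart_dom i `&` U) =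
    (chart i @` chart_dom i) `&` (chart_inv i @^-1` U).
  apply/seteqP; split=> [_ [x [Dx Ux] <-]|_ [[x Dx <-]]] /=.
    by split; [exists x|rewrite chartK].
  by rewrite chartK // => Ux; exists x.
have oD : open (chart i @` chart_dom i) by exact: chart_img_open.
rewrite openE => y [Dy Uy].
apply: filterI; first exact: open_nbhs_nbhs.
exact: (chart_inv_continuous Dy) (open_nbhs_nbhs (conj oU Uy)).
Qed.

Lemma msmooth_on_ext U f g : open U -> (forall x, U x -> f x = g x) ->
  msmooth_on U f -> msmooth_on U g.
Proof.
move=> oU fg sf i k; apply: Ck_on_ext (chart_open_img (i := i) oU) _ (sf i k).
by move=> _ [x [Dx Ux] <-]; rewrite chartK //; exact: fg.
Qed.

Lemma msmooth_onD U f g : open U -> msmooth_on U f -> msmooth_on U g ->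
  msmooth_on U (fun x => f x + g x).
Proof.
move=> oU sf sg i k.
exact: Ck_onD (chart_open_img (i := i) oU) (sf i k) (sg i k).
Qed.

Lemma msmooth_onM U f g : open U -> msmooth_on U f -> msmooth_on U g ->
  msmooth_on U (fun x => f x * g x).
Proof.
move=> oU sf sg i k.
exact: Ck_onM (chart_open_img (i := i) oU) (sf i k) (sg i k).
Qed.

Lemma msmooth_on_cst U (c : R) : msmooth_on U (fun=> c).
Proof. by move=> i k; exact: Ck_on_cst. Qed.

Lemma msmooth_on_sum U (I : Type) (s : seq I) (F : I -> M -> R) : open U ->
  (forall i, msmooth_on U (F i)) -> msmooth_on U (fun x => \sum_(i <- s) F i x).
Proof.
move=> oU sF; elim: s => [|i s IH].
  by rewrite (_ : (fun x => _) = fun=> 0);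
    [exact: msmooth_on_cst|apply/funext => x; rewrite big_nil].
rewrite (_ : (fun x => _) = fun x => F i x + \sum_(i <- s) F i x).
  exact: msmooth_onD.
by apply/funext => x; rewrite big_cons.
Qed.

(** Smoothness is local. *)
Lemma msmooth_cover (I : Type) (U : I -> set M) f :
  (forall x, exists i, U i x) -> (forall i, msmooth_on (U i) f) -> msmooth f.
Proof.
move=> cU sf i k.
rewrite (_ : _ @` _ = \bigcup_a chart i @` (chart_dom i `&` U a)).
  by apply: Ck_on_bigcup => a; exact: sf.
apply/seteqP; split=> [_ [x [Dx _] <-]|_ [a _ [x [Dx _] <-]]].
  by have [a Ux] := cU x; exists a => //; exists x.
by exists x.
Qed.

(** Freezing the second variable of a function smooth on U x R leaves a
    function smooth on U. *)
Lemma msmooth_on_slice U (f : prodR M -> R) (t : R) :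
  @msmooth_on R (n + 1) (prodR M) (U `*` setT) f ->
  msmooth_on U (fun x => f (x, t)).
Proof.
move=> sf i; have := sf i; rewrite /= prodR_img.
move=> /(smooth_on_row_mxl t%:M).
rewrite (_ : (fun y => _) = fun y => f (chart_inv i y, t)).
  by apply: smooth_on_subset => y; rewrite /= row_mxKl.
by apply/funext => y; rewrite row_mxKl row_mxKr mxE eqxx mulr1n.
Qed.

(** A function smooth on U x R is differentiable along the line through
    each point of U. *)
Lemma msmooth_on_derivable_time U (f : prodR M -> R) (x : M) (t : R) : U x ->
  @msmooth_on R (n + 1) (prodR M) (U `*` setT) f ->
  derivable (fun s => f (x, s)) t 1.
Proof.
move=> Ux sf; have [i Dx] := chart_cover x.
have := sf i; rewrite /= prodR_img.
move=> /(_ 1%N)[_ /(_ (rshift n ord0))[+ _]] => /(_ (row_mx (chart i x) t%:M)).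
rewrite /= row_mxKl => /(_ (ex_intro2 _ _ x (conj Dx Ux) erefl)).
rewrite /derivable; set F := (X in cvg (X @ _) -> _).
set G := (X in _ -> cvg (X @ _)); suff -> : F = G by [].
apply/funext => h; rewrite /F /G /= -[delta_mx _ _]hsubmxK.
have -> : lsubmx (delta_mx 0 (rshift n ord0) : 'rV[R]_(n + 1)) = 0.
  by apply/rowP => l; rewrite !mxE eq_lrshift.
have -> : rsubmx (delta_mx 0 (rshift n ord0) : 'rV[R]_(n + 1)) = 1%:M.
  by apply/matrixP => l m; rewrite !mxE !ord1 !eqxx.
rewrite scale_row_mx scaler0 add_row_mx add0r !row_mxKl !row_mxKr chartK //.
by rewrite !mxE !mulr1n.
Qed.

End ManifoldSmoothness.

(** * Curves in a finite-dimensional vector space *)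

Section Curves.
Context {R : realType}.
Implicit Types V W : vectType R.

Lemma scalar_sum V (f : V -> R) (I : Type) (s : seq I) (a : I -> R)
    (v : I -> V) : scalar f ->
  f (\sum_(i <- s) a i *: v i) = \sum_(i <- s) a i * f (v i).
Proof.
move=> lf; have f0 : f 0 = 0.
  by have := lf 1 0 0; rewrite scaler0 addr0 mul1r -[LHS]addr0 => /addrI.
elim: s => [|i s IH]; first by rewrite !big_nil.
by rewrite !big_cons lf IH.
Qed.

Lemma scalar_coordE V (f : V -> R) (u : V) : scalar f ->
  f u = \sum_i coord (vbasis {:V}) i u * f (vbasis {:V})`_i.
Proof. by move=> lf; rewrite {1}(coord_vbasis (memvf u)) scalar_sum. Qed.

(** Differentiability at [t], read in the basis that [curve_derive] uses. *)
Definition curve_derivable V (c : R -> V) (t : R) : Prop :=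
  forall i, derivable (fun s => coord (vbasis {:V}) i (c s)) t 1.

Lemma is_derive_sum_fun n (h : 'I_n -> R -> R) (t : R) (dh : 'I_n -> R) :
  (forall i, is_derive t 1 (h i) (dh i)) ->
  is_derive t 1 (fun s => \sum_i h i s) (\sum_i dh i).
Proof.
move=> hd; rewrite (_ : (fun s => _) = \sum_i h i); first exact: is_derive_sum.
by apply/funext => s; rewrite fct_sumE.
Qed.

Lemma coord_curve_derive V (c : R -> V) t i :
  coord (vbasis {:V}) i (curve_derive c t) =
  derive1 (fun s => coord (vbasis {:V}) i (c s)) t.
Proof.
rewrite /curve_derive coord_sum_free //; exact: basis_free (vbasisP fullv).
Qed.

Lemma is_derive_coord V (c : R -> V) t i : curve_derivable c t ->
  is_derive t 1 (fun s => coord (vbasis {:V}) i (c s))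
                (coord (vbasis {:V}) i (curve_derive c t)).
Proof.
move=> dc; rewrite coord_curve_derive derive1E.
apply: derivableP; exact: dc.
Qed.

(** A linear form commutes with differentiation of curves. *)
Lemma is_derive_scalar V (f : V -> R) (c : R -> V) t : scalar f ->
  curve_derivable c t ->
  is_derive t 1 (fun s => f (c s)) (f (curve_derive c t)).
Proof.
move=> lf dc; rewrite (scalar_coordE _ lf).
rewrite (_ : (fun s => _) =
  fun s => \sum_i coord (vbasis {:V}) i (c s) * f (vbasis {:V})`_i); last first.
  by apply/funext => s; exact: scalar_coordE.
apply: is_derive_sum_fun => i; have dci := is_derive_coord i dc.
apply: (is_derive_eq (is_deriveM dci (is_derive_cst (f (vbasis {:V})`_i) t 1))).
by rewrite scaler0 add0r /GRing.scale /= mulrC.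
Qed.

Lemma is_derive_bilinear V (B : V -> V -> R) (c d : R -> V) t :
  (forall v, scalar (B^~ v)) -> (forall u, scalar (B u)) ->
  curve_derivable c t -> curve_derivable d t ->
  is_derive t 1 (fun s => B (c s) (d s))
            (B (curve_derive c t) (d t) + B (c t) (curve_derive d t)).
Proof.
move=> lB rB dc dd.
rewrite (scalar_coordE (curve_derive c t) (lB (d t))).
rewrite (scalar_coordE (c t) (lB (curve_derive d t))).
rewrite -big_split /=.
rewrite (_ : (fun s => _) = fun s =>
  \sum_i coord (vbasis {:V}) i (c s) * B (vbasis {:V})`_i (d s)); last first.
  by apply/funext => s; exact: (scalar_coordE (f := B^~ (d s))).
apply: is_derive_sum_fun => i; have dci := is_derive_coord i dc.
apply: (is_derive_eq (is_deriveM dci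
  (is_derive_scalar (rB (vbasis {:V})`_i) dd))).
by rewrite /GRing.scale /= addrC; congr (_ + _); exact: mulrC.
Qed.

Lemma curve_derive_linear V W (L : {linear V -> W}) (c : R -> V) t :
  curve_derivable c t ->
  curve_derive (fun s => L (c s)) t = L (curve_derive c t).
Proof.
move=> dc; rewrite [RHS](coord_vbasis (memvf _)); apply: eq_bigr => i _.
have lf : scalar (fun u => coord (vbasis {:W}) i (L u)).
  by move=> a u v; rewrite !linearP.
have := is_derive_scalar lf dc.
by move=> df; rewrite derive1E derive_val.
Qed.

End Curves.

(** * Sections, forms and tensors in local frames *)

Section Forms.
Context {R : realType} {n : nat} {M : manifold R n} {r : nat}.
Implicit Type E : vbundle M r.

Lemma pair2K (T : Type) (v : 'I_2 -> T) : v = pair2 (v ord0) (v ord_max).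
Proof.
apply/funext => i; rewrite /pair2; case: eqP => [-> //|i0].
by congr v; apply/val_inj; case: i i0 => -[|[|]] // Hi; case; exact/val_inj.
Qed.

Lemma frame_sum E (a : triv_index E) (x : M) (u : E x) : triv_dom a x ->
  u = \sum_i triv a x u 0 i *: frame a i x.
Proof.
move=> Dx; apply: (can_inj (trivK Dx)); rewrite linear_sum /=.
rewrite [LHS]row_sum_delta; apply: eq_bigr => i _.
by rewrite linearZ /= /frame triv_invK.
Qed.

Lemma form2_scalarl E (w : kform E 2) (fw : is_form w) x (v : E x) :
  scalar (fun u => w x (pair2 u v)).
Proof.
move=> a u1 u2.
have ev u : [eta pair2 u1 v with ord0 |-> u] = pair2 u v :> ('I_2 -> E x).
  by apply/funext => i; rewrite /= /pair2; case: eqP.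
by have := form_linear fw (pair2 u1 v) ord0 a u1 u2; rewrite !ev.
Qed.

Lemma form2_scalarr E (w : kform E 2) (fw : is_form w) x (u : E x) :
  scalar (fun v => w x (pair2 u v)).
Proof.
move=> a v1 v2.
have ev v : [eta pair2 u v1 with ord_max |-> v] = pair2 u v :> ('I_2 -> E x).
  by rewrite [LHS]pair2K.
by have := form_linear fw (pair2 u v1) ord_max a v1 v2; rewrite !ev.
Qed.

Lemma form2_anti E (w : kform E 2) (fw : is_form w) x (u v : E x) :
  w x (pair2 u v) = - w x (pair2 v u).
Proof.
have alt z : w x (pair2 z z) = 0.
  exact: (form_alternating fw (i := ord0) (j := ord_max)).
(* Polarization. *)
have := alt (1 *: u + v).
rewrite (form2_scalarl fw) !(form2_scalarr fw) !alt !mul1r add0r addr0.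
by move/eqP; rewrite addr_eq0 => /eqP.
Qed.

Lemma form2_smooth_on E (w : kform E 2) (fw : is_form w) (a : triv_index E)
    (X Y : section E) :
  (forall i, msmooth_on (triv_dom a) (fun x => triv a x (X x) 0 i)) ->
  (forall i, msmooth_on (triv_dom a) (fun x => triv a x (Y x) 0 i)) ->
  msmooth_on (triv_dom a) (fun x => w x (pair2 (X x) (Y x))).
Proof.
move=> sX sY; have oD : open (triv_dom a) by exact: triv_dom_open.
apply: (@msmooth_on_ext _ _ _ _ (fun x => \sum_i triv a x (X x) 0 i *
  \sum_j triv a x (Y x) 0 j * w x (pair2 (frame a i x) (frame a j x)))) => //.
  move=> x Dx; rewrite [in RHS](frame_sum (X x) Dx).
  rewrite (scalar_sum _ _ _ (form2_scalarl fw (Y x))); apply: eq_bigr => i _.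
  rewrite [in RHS](frame_sum (Y x) Dx).
  by rewrite (scalar_sum _ _ _ (form2_scalarr fw (frame a i x))).
apply: msmooth_on_sum => // i; apply: msmooth_onM => //.
apply: msmooth_on_sum => // j; apply: msmooth_onM => //.
have := form_smooth fw a (pair2 i j).
by under eq_fun do rewrite [X in w _ X]pair2K.
Qed.

Lemma form2_smooth E (w : kform E 2) (fw : is_form w) (X Y : section E) :
  smooth_section X -> smooth_section Y ->
  msmooth (fun x => w x (pair2 (X x) (Y x))).
Proof.
move=> sX sY; apply: (msmooth_cover (triv_cover E)) => a.
exact: form2_smooth_on (sX a) (sY a).
Qed.

(** Compatibility with [N] says that [w (N u) v = w u (N v)], which is what
    makes [form_tensor w N] alternating. *)
Lemma is_form_tensor E (w : kform E 2) (fw : is_form w) (N : tensor11 E) :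
  (forall x, flat w (x := x) \o N x =
             tensor_dual N (x := x) \o flat w (x := x)) ->
  smooth_tensor11 N -> is_form (form_tensor w N).
Proof.
move=> wN sN.
have wNE x u v : w x (pair2 (N x u) v) = w x (pair2 u (N x v)).
  exact: (congr1 (fun f => f u v) (wN x)).
split=> [x v i a u1 u2|x v i j ij vij|a I].
- rewrite /form_tensor /=.
  have [->|i0] := eqVneq i ord0.
    by rewrite linearP (form2_scalarl fw).
  have -> : i = ord_max by case: i i0 => -[|[|]] // ? _; exact/val_inj.
  by rewrite (form2_scalarr fw).
- have v01 : v ord0 = v ord_max.
    case: i j ij vij => -[|[|//]] Hi [[|[|//]] Hj] // _.
      by congr (v _ = v _); exact/val_inj.
    by move=> /esym; congr (v _ = v _); exact/val_inj.
  rewrite /form_tensor v01; have := wNE x (v ord_max) (v ord_max).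
  by rewrite [RHS](form2_anti fw); lra.
- apply: (form2_smooth_on fw (X := fun x => N x (frame a (I ord0) x))
    (Y := frame a (I ord_max))) => i; first exact: sN.
  apply: (@msmooth_on_ext _ _ _ _
    (fun=> (delta_mx 0 (I ord_max) : 'rV[R]_r) 0 i)).
  + exact: triv_dom_open.
  + by move=> x Dx; rewrite /frame triv_invK.
  + exact: msmooth_on_cst.
Qed.

End Forms.

(** * The differential and the wedge product of a 2-form *)

Section Degree2.
Context {R : realType} {n : nat} {M : manifold R n} {r : nat}.

(** The indices of ['I_3] are written [inord 0], [inord 1], [inord 2]. *)
Lemma dA2E (A : algebroid M r) (w : kform A 2) (X : 'I_3 -> section A) x :
  dA w X x =
    anchor A (X (inord 0) x)
      (fun y => w y (pair2 (X (inord 1) y) (X (inord 2) y)))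
    - anchor A (X (inord 1) x)
      (fun y => w y (pair2 (X (inord 0) y) (X (inord 2) y)))
    + anchor A (X (inord 2) x)
      (fun y => w y (pair2 (X (inord 0) y) (X (inord 1) y)))
    - w x (pair2 (bracket (X (inord 0)) (X (inord 1)) x) (X (inord 2) x))
    + w x (pair2 (bracket (X (inord 0)) (X (inord 2)) x) (X (inord 1) x))
    - w x (pair2 (bracket (X (inord 1)) (X (inord 2)) x) (X (inord 0) x)).
Proof.
have e0 : ord0 = inord 0 :> 'I_3 by apply/val_inj; rewrite /= inordK.
have e1 : lift ord0 ord0 = inord 1 :> 'I_3.
  by apply/val_inj; rewrite /= inordK.
have e2 : lift ord0 (lift ord0 ord0) = inord 2 :> 'I_3.
  by apply/val_inj; rewrite /= inordK.
have liftE (i j : 'I_3) (k : 'I_2) : bump i k = j -> lift i k = j.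
  by move=> ij; apply/val_inj.
have aE (i j k : 'I_3) : bump i 0 = j -> bump i 1 = k ->
    (fun y => w y (fun l => X (lift i l) y)) =
    (fun y => w y (pair2 (X j y) (X k y))).
  move=> ij ik; apply/funext => y; rewrite [X in w _ X]pair2K.
  by rewrite (liftE i j) // (liftE i k).
have bE (Z : A x) (i j : nat) (k : 'I_3) : bump i (bump j 0) = k ->
    w x (fun l : 'I_2 => if l == 0 :> nat then Z
                         else X (inord (bump i (bump j l.-1))) x) =
    w x (pair2 Z (X k x)).
  move=> ijk; rewrite [X in w _ X]pair2K /= ijk.
  by congr (w _ (pair2 _ (X _ _))); apply/val_inj; rewrite /= inordK.
rewrite /dA.
under [X in _ + X]eq_bigr do rewrite big_mkcond.
rewrite !big_ord_recl !big_ord0 /= e2 e1 e0.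
rewrite (aE _ (inord 1) (inord 2)) ?inordK //.
rewrite (aE _ (inord 0) (inord 2)) ?inordK //.
rewrite (aE _ (inord 0) (inord 1)) ?inordK //.
rewrite (bE _ _ _ (inord 2)) ?inordK //.
rewrite (bE _ _ _ (inord 1)) ?inordK //.
rewrite (bE _ _ _ (inord 0)) ?inordK //.
rewrite /=; ring.
Qed.

Lemma wedge12E (E : vbundle M r) (phi : kform E 1) (w : kform E 2) x
    (v : 'I_3 -> E x) :
  wedge1 phi w v =
    pairing phi (v (inord 0)) * w x (pair2 (v (inord 1)) (v (inord 2)))
    - pairing phi (v (inord 1)) * w x (pair2 (v (inord 0)) (v (inord 2)))
    + pairing phi (v (inord 2)) * w x (pair2 (v (inord 0)) (v (inord 1))).
Proof.
have e0 : ord0 = inord 0 :> 'I_3 by apply/val_inj; rewrite /= inordK.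
have e1 : lift ord0 ord0 = inord 1 :> 'I_3.
  by apply/val_inj; rewrite /= inordK.
have e2 : lift ord0 (lift ord0 ord0) = inord 2 :> 'I_3.
  by apply/val_inj; rewrite /= inordK.
have aE (i j k : 'I_3) : bump i 0 = j -> bump i 1 = k ->
    w x (fun l => v (lift i l)) = w x (pair2 (v j) (v k)).
  move=> ij ik; rewrite [X in w _ X]pair2K.
  by congr (w _ (pair2 (v _) (v _))); apply/val_inj.
rewrite /wedge1 !big_ord_recl !big_ord0 /= e2 e1 e0.
rewrite (aE _ (inord 1) (inord 2)) ?inordK //.
rewrite (aE _ (inord 0) (inord 2)) ?inordK //.
rewrite (aE _ (inord 0) (inord 1)) ?inordK //.
rewrite /=; ring.
Qed.

End Degree2.

(** * The algebroid over M x R *)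

Section TildeAlgebroid.
Context {R : realType} {n : nat} {M : manifold R n} {r : nat}.

Lemma smooth_slice (E : vbundle M r) (X : section (tilde_bundle E)) t :
  smooth_section X -> smooth_section (slice X t).
Proof.
move=> sX a i.
exact: (@msmooth_on_slice _ _ _ _ (fun p : prodR M => triv a p.1 (X p) 0 i)
  t (sX a i)).
Qed.

(** The section of the pulled-back bundle that does not depend on time. *)
Definition constant_section (E : vbundle M r) (X : section E)
  : section (tilde_bundle E) := fun p => X p.1.

Lemma smooth_constant_section (E : vbundle M r) (X : section E) :
  smooth_section X -> smooth_section (constant_section X).
Proof. by move=> sX a i; exact: msmooth_on_fst (sX a i). Qed.

Lemma smooth_curve_derivable (E : vbundle M r) (X : section (tilde_bundle E))
    x t : smooth_section X -> curve_derivable (fun s => slice X s x) t.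
Proof.
move=> sX k; have [a Dx] := triv_cover E x.
have lc : scalar (coord (vbasis {: E x}) k) by move=> c u v; rewrite linearP.
rewrite (_ : (fun s => _) = \sum_j (fun s => triv a x (X (x, s)) 0 j) *
    cst (coord (vbasis {: E x}) k (frame a j x))); last first.
  apply/funext => s; rewrite fct_sumE /slice.
  by rewrite [in LHS](frame_sum (E := E) (X (x, s)) Dx) (scalar_sum _ _ _ lc).
apply: derivable_sum => j; apply: derivableM; last exact: derivable_cst.
exact: (@msmooth_on_derivable_time _ _ _ _
  (fun p : prodR M => triv a p.1 (X p) 0 j) x t Dx (sX a j)).
Qed.

Lemma torsion_cancel (V : zmodType) (b0 b1 b2 b3 p q u v : V) :
  b0 + p - q - (b1 + p - v) - (b2 + u - q) + (b3 + u - v) = b0 - b1 - b2 + b3.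
Proof.
rewrite !opprD !opprK.
(* Bring [b0], [- b1], [- b2], [b3] to the front and pair off the rest. *)
rewrite [LHS](AC (3*3*3*3)
  ((1*4*7*10) * ((2*5) * (9*3) * ((11*8) * (6*12))))%AC) /=.
by rewrite !subrr !addr0.
Qed.

(** All the time derivatives cancel, since [N] does not depend on time and so
    commutes with [time_derive]. *)
Lemma tilde_torsion (A : algebroid M r) (phi0 : kform A 1) (N : tensor11 A)
    (X Y : section (tilde_bundle A)) x t :
  smooth_section X -> smooth_section Y ->
  torsion (A := tilde_algebroid phi0) (tilde_tensor N) X Y (x, t) =
  torsion N (slice X t) (slice Y t) x.
Proof.
move=> sX sY.
have NE (Z : section (tilde_bundle A)) : smooth_section Z ->
    time_derive (tensor_app (tilde_tensor N) Z) (x, t) =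
    N x (time_derive Z (x, t)).
  move=> sZ; apply: (curve_derive_linear (N x)).
  exact: smooth_curve_derivable.
have NL (u v z : A x) (a b : R) :
    N x (u + a *: v - b *: z) = N x u + a *: N x v - b *: N x z.
  by rewrite linearB linearD !linearZ.
rewrite /torsion /= !NE // /tilde_tensor /= !NL.
exact: torsion_cancel.
Qed.

(** The constant [c] comes out by linearity with the zero function as second
    term, so its image has to be shown to vanish first. *)
Lemma tangent_scale (A : algebroid M r) (x : M) (u : A x) (c : R) f :
  lie_algebroid A -> msmooth f ->
  anchor A u (fun y => c * f y) = c * anchor A u f.
Proof.
move=> lA sf; have tu := anchor_tangent lA u.
have s0 : @msmooth R n M (fun=> 0) by exact: msmooth_on_cst.
have D0 : anchor A u (fun=> 0) = 0.
  have := tangent_linear tu (- 1) s0 s0.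
  have -> : (fun y : M => -1 * 0 + 0 : R) = fun=> 0.
    by apply/funext => y; rewrite mulr0 addr0.
  by rewrite mulN1r addNr.
have := tangent_linear tu c sf s0; rewrite D0 addr0.
by under [in X in X -> _]eq_fun do rewrite addr0.
Qed.

(** The anchor of [tilde_algebroid phi0] applied to [exp(t) w(Y, Z)]. *)
Lemma tilde_anchor_exp (A : algebroid M r) (phi0 : kform A 1) (w : kform A 2)
    (Y Z : section (tilde_bundle A)) x t (u : A x) :
  lie_algebroid A -> is_form w -> smooth_section Y -> smooth_section Z ->
  @anchor _ _ _ _ (tilde_algebroid phi0) (x, t) u
    (fun p => exp_form w (pair2 (Y p) (Z p))) =
  expR t * (anchor A u (fun y => w y (pair2 (slice Y t y) (slice Z t y)))
    + pairing phi0 u * (w x (pair2 (slice Y t x) (slice Z t x))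
      + w x (pair2 (time_derive Y (x, t)) (slice Z t x))
      + w x (pair2 (slice Y t x) (time_derive Z (x, t))))).
Proof.
move=> lA fw sY sZ; rewrite /= /exp_form /=.
rewrite (tangent_scale _ _ lA); last first.
  by apply: (form2_smooth fw); exact: smooth_slice.
rewrite derive1E.
have dw := is_derive_bilinear (form2_scalarl fw (x := x))
  (form2_scalarr fw (x := x)) (smooth_curve_derivable (t := t) sY)
  (smooth_curve_derivable (t := t) sZ).
have dew := @derive_val _ _ _ _ _ _ _ (is_deriveM (is_derive_expR t) dw).
rewrite [X in _ + _ * X = _]dew.
rewrite /GRing.scale /= /time_derive /=; ring.
Qed.

(** The differential of [exp(t) w] at [(x, t)] is exp(t) times the twisted
    differential of [w] on the slices at time [t]: differentiating exp(t)
    produces the wedge product with [phi0], and the derivatives of the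
    sections cancel those in the bracket. *)
Lemma tilde_dA_exp (A : algebroid M r) (phi0 : kform A 1) (w : kform A 2)
    (X : 'I_3 -> section (tilde_bundle A)) x t :
  lie_algebroid A -> is_form w -> (forall i, smooth_section (X i)) ->
  dA_phi (A := tilde_algebroid phi0) (zero_form (tilde_algebroid phi0) 1)
    (exp_form w) X (x, t) =
  expR t * dA_phi phi0 w (fun i => slice (X i) t) x.
Proof.
move=> lA fw sX; rewrite /dA_phi !dA2E !wedge12E.
rewrite !(tilde_anchor_exp _ _ _ lA fw) //.
rewrite /pairing /zero_form !mul0r subrr !addr0 /exp_form /=.
have lw (v u1 u2 u3 : A x) (a b : R) :
    w x (pair2 (u1 + a *: u2 - b *: u3) v) =
    w x (pair2 u1 v) + a * w x (pair2 u2 v) - b * w x (pair2 u3 v).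
  rewrite addrC -scaleNr (form2_scalarl fw) [u1 + _]addrC (form2_scalarl fw).
  by rewrite mulNr addrC; congr (_ - _); exact: addrC.
have sl i : slice (X i) t x = X i (x, t) by [].
have wC := form2_anti fw (x := x) (time_derive (X _) (x, t)).
rewrite !lw /pairing !sl.
rewrite (wC (inord 2) (X (inord 1) (x, t))) (wC (inord 2) (X (inord 0) (x, t))).
rewrite (wC (inord 1) (X (inord 0) (x, t))).
ring.
Qed.

Lemma tilde_closed (A : algebroid M r) (phi0 : kform A 1) (w : kform A 2) :
  lie_algebroid A -> is_form w ->
  phi_closed phi0 w <->
  phi_closed (A := tilde_algebroid phi0) (zero_form (tilde_algebroid phi0) 1)
    (exp_form w).
Proof.
move=> lA fw; split=> [cw X sX [x t]|cw X sX x].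
  rewrite tilde_dA_exp // cw ?mulr0 // => i; exact: smooth_slice.
(* At time 0 the factor exp(t) is 1. *)
have := cw (fun i => constant_section (X i))
  (fun i => smooth_constant_section (sX i)) (x, 0).
rewrite tilde_dA_exp //; last by move=> i; exact: smooth_constant_section.
by rewrite expR0 mul1r.
Qed.

Lemma tilde_compatible (E : vbundle M r) (w : kform E 2) (N : tensor11 E) :
  (forall x, flat w (x := x) \o N x =
             tensor_dual N (x := x) \o flat w (x := x)) <->
  (forall p, flat (exp_form w) (x := p) \o tilde_tensor N p =
     tensor_dual (tilde_tensor N) (x := p) \o flat (exp_form w) (x := p)).
Proof.
split=> [wN [x t]|wN x]; apply/funext => u; apply/funext => v.
  congr (expR t * _); exact: (congr1 (fun f => f u v) (wN x)).
have : expR 0 * w x (pair2 (N x u) v) = expR 0 * w x (pair2 u (N x v)).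
  exact: (congr1 (fun f => f u v) (wN (x, 0))).
by rewrite expR0 !mul1r.
Qed.

(** [P] is any fibrewise condition: vanishing for the Nijenhuis property,
    lying in the kernel of [flat w] for the weak structures. *)
Lemma tilde_torsion_all (A : algebroid M r) (phi0 : kform A 1)
    (N : tensor11 A) (P : forall x, A x -> Prop) :
  (forall X Y : section A, smooth_section X -> smooth_section Y ->
     forall x, P x (torsion N X Y x)) <->
  (forall X Y : section (tilde_bundle A),
     smooth_section X -> smooth_section Y ->
     forall p, P p.1 (torsion (A := tilde_algebroid phi0)
                        (tilde_tensor N) X Y p)).
Proof.
split=> [tN X Y sX sY [x t]|tN X Y sX sY x].
  rewrite tilde_torsion //; apply: tN; exact: smooth_slice.
have := tN _ _ (smooth_constant_section sX) (smooth_constant_section sY) (x, 0).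
by rewrite tilde_torsion //; exact: smooth_constant_section.
Qed.

Lemma flat_exp_eq0 (E : vbundle M r) (w : kform E 2) (p : prodR M)
    (u : E p.1) :
  flat (exp_form w) (x := p) u = (fun=> 0) <-> flat w u = (fun=> 0).
Proof.
split=> w0; apply/funext => v; last first.
  by have := congr1 (@^~ v) w0; rewrite /flat /exp_form => ->; rewrite mulr0.
have := congr1 (@^~ v) w0; rewrite /flat /exp_form => /eqP.
by rewrite mulf_eq0 gt_eqF ?expR_gt0 //= => /eqP.
Qed.

End TildeAlgebroid.

Theorem proposition4p5 (R : realType) (n : nat) (M : manifold R n) (r : nat)
    (A : algebroid M r) (phi0 : kform A 1) (w : kform A 2) (N : tensor11 A) :
  jacobi_algebroid phi0 -> is_form w -> smooth_tensor11 N ->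
  (OmegaN_structure phi0 w N <->
   OmegaN_structure (A := tilde_algebroid phi0)
     (zero_form (tilde_algebroid phi0) 1) (exp_form w) (tilde_tensor N))
  /\
  (weak_OmegaN_structure phi0 w N <->
   weak_OmegaN_structure (A := tilde_algebroid phi0)
     (zero_form (tilde_algebroid phi0) 1) (exp_form w) (tilde_tensor N)).
Proof.
move=> [lA _ _] fw sN.
have nE := tilde_torsion_all phi0 N (fun x u => u = 0).
have wE := tilde_torsion_all phi0 N (fun x u => flat w u = (fun=> 0)).
have cE := tilde_closed phi0 lA fw.
(* [form_tensor (exp_form w) (tilde_tensor N)] is [exp_form (form_tensor w N)]
   by computation. *)
have cNE wN := tilde_closed phi0 lA (is_form_tensor fw wN sN).
split; split=> -[wN tN cw cwN].
- split; [exact: (tilde_compatible w N).1|exact: nE.1|exact: cE.1|].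
  exact: (cNE wN).1.
- have wN' := (tilde_compatible w N).2 wN.
  split=> //; [exact: nE.2|exact: cE.2|exact: (cNE wN').2].
- split; [exact: (tilde_compatible w N).1| |exact: cE.1|exact: (cNE wN).1].
  by move=> X Y sX sY p; apply/flat_exp_eq0; exact: wE.1 tN _ _ sX sY p.
- have wN' := (tilde_compatible w N).2 wN.
  split=> //; [|exact: cE.2|exact: (cNE wN').2].
  by apply: wE.2 => X Y sX sY p; apply/(flat_exp_eq0 w); exact: tN.
Qed.
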